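(* Let $s\ge 1$ be an integer, let $z_0,z_1,\ldots,z_s\in\mathbb{C}$, and let $$r(z_0,z_1,\ldots,z_s)=1+\frac{\big(1+\frac12 z_0\big)\sum_{j=0}^s z_j}{\prod_{j=1}^s\big(1-\frac12 z_j\big)}.$$ Then the stability condition $|r(z_0,z_1,\ldots,z_s)|\le 1$ is valid if either (i) $s=1$, $|1+z_0|\le 1$ and $z_1\in\mathcal{W}_{\pi/2}$; or (ii) $s\ge 2$, $|1+z_0|\le 1$ and $z_j\in\mathcal{W}_0$ for $j=1,2,\ldots,s$.
   Context: For $\alpha\in[0,\frac12\pi]$, $\mathcal{W}_\alpha=\{\zeta\in\mathbb{C}:\ \zeta=0\ \text{or}\ |\arg(-\zeta)|\le\alpha\}$ is the closed wedge of angle $\alpha$ in the left half-plane. Thus $\mathcal{W}_{\pi/2}$ is the closed left half-plane $\{\zeta:\operatorname{Re}\zeta\le 0\}$ and $\mathcal{W}_0$ is the set of real numbers $\le 0$. (The function $r$ is the stability function of the modified Douglas splitting methods, i.e. one step applied to $u'=(\lambda_0+\cdots+\lambda_s)u$ with $z_j=\Delta t\,\lambda_j$ gives $u_n=r(z_0,\ldots,z_s)u_{n-1}$.) *)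

(* Defs.v *)
From HB Require Import structures.
From mathcomp Require Import all_boot all_order all_algebra.
From mathcomp Require Import complex ring lra.
From mathcomp Require Import all_classical all_reals all_analysis.

Set Implicit Arguments.
Unset Strict Implicit.
Unset Printing Implicit Defensive.

Import Order.TTheory GRing.Theory Num.Theory.
Import numFieldNormedType.Exports.

Local Open Scope classical_set_scope.
Local Open Scope ring_scope.
Local Open Scope complex_scope.

(* Principal argument; [arg 0] is unspecified. *)
Definition arg (R : realType) (z : R[i]) : R :=
  get [set t : R | - pi < t <= pi /\ z = `|z| * (cos t +i* sin t)].

Definition wedge (R : realType) (alpha : R) : set R[i] :=
  [set z | z = 0 \/ `|arg (- z)| <= alpha].

Definition stab_fun (R : realType) (s : nat) (z : 'I_s.+1 -> R[i]) : R[i] :=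
  1 + (1 + 2^-1 * z ord0) * (\sum_(j < s.+1) z j)
      / \prod_(j < s.+1 | (0 < j)%N) (1 - 2^-1 * z j).

Lemma argP (R : realType) (z : R[i]) : z != 0 ->
  - pi < arg z <= pi /\ z = `|z| * (cos (arg z) +i* sin (arg z)).
Proof.
move=> z0.
pose P := [set t : R | - pi < t <= pi /\ z = `|z| * (cos t +i* sin t)].
suff [t Pt] : exists t, P t by exact: (@getI _ P t Pt).
case: z z0 @P => a b z0 P.
set n := Num.sqrt (a ^+ 2 + b ^+ 2).
have d0 : 0 < a ^+ 2 + b ^+ 2.
  rewrite lt_neqAle addr_ge0 ?sqr_ge0// andbT eq_sym paddr_eq0 ?sqr_ge0//.
  by rewrite !sqrf_eq0; move: z0; rewrite eq_complex.
have n0 : 0 < n by rewrite sqrtr_gt0.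
have n2 : n ^+ 2 = a ^+ 2 + b ^+ 2 by rewrite sqr_sqrtr ?ltW.
have hx : -1 <= a / n <= 1.
  rewrite -ler_norml normrM normfV (gtr0_norm n0) ler_pdivrMr// mul1r.
  by rewrite -sqrtr_sqr ler_wsqrtr// lerDl sqr_ge0.
have hs : sin (acos (a / n)) = `|b| / n.
  rewrite sin_acos// expr_div_n n2.
  have -> : 1 - a ^+ 2 / (a ^+ 2 + b ^+ 2) = (`|b| / n) ^+ 2.
    by rewrite expr_div_n n2 real_normK ?num_real//; field; rewrite gt_eqF.
  by rewrite sqrtr_sqr ger0_norm// divr_ge0// ltW.
have hc : cos (acos (a / n)) = a / n by rewrite acosK// in_itv.
have polar u v : (a +i* b = `|a +i* b| * (u +i* v)) <-> (a = n * u /\ b = n * v).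
  rewrite normc_def /= -/n; split.
    by case=> -> ->; rewrite !mul0r subr0 addr0.
  by move=> [eu ev]; apply/eqP; rewrite eq_complex /= !mul0r subr0 addr0 -eu -ev !eqxx.
have nN0 : n != 0 by rewrite gt_eqF.
have [b0|b0] := leP 0 b.
  exists (acos (a / n)); split.
    rewrite acos_lepi// andbT (lt_le_trans _ (acos_ge0 hx))//.
    by rewrite oppr_lt0 pi_gt0.
  by apply/polar; rewrite hc hs ger0_norm//; split; field.
exists (- acos (a / n)); split.
  apply/andP; split; last first.
    by rewrite (le_trans _ (pi_ge0 R))// oppr_le0 acos_ge0.
  rewrite ltrN2 acos_ltpi//; case/andP: hx => h1 h2; rewrite h2 andbT.
  rewrite lt_neqAle h1 andbT; apply/eqP => e.
  have an : a = - n by rewrite -[a](divfK nN0) -e mulN1r.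
  by move: n2; rewrite an sqrrN => /eqP; rewrite -subr_eq0 opprD addNKr oppr_eq0 sqrf_eq0 lt_eqF.
by apply/polar; rewrite cosN sinN hc hs ltr0_norm//; split; field.
Qed.

Lemma wedgeP (R : realType) (alpha : R) (z : R[i]) : 0 <= alpha <= pi ->
  wedge alpha z <->
  Num.sqrt (complex.Re z ^+ 2 + complex.Im z ^+ 2) * cos alpha <= - complex.Re z.
Proof.
move=> alpha0pi; rewrite /wedge /=.
have [->|z0] := eqVneq z 0.
  by split=> [_|]; [rewrite /= expr0n addr0 sqrtr0 mul0r oppr0|left].
have Nz0 : - z != 0 by rewrite oppr_eq0.
have [/andP[lt_t t_le]] := argP Nz0.
set t := arg (- z) in lt_t t_le *; rewrite normrN normc_def.
set n := Num.sqrt _ => polar.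
have ReE : - complex.Re z = n * cos t.
  have := congr1 (@complex.Re R) polar.
  by case: (z) => a b /=; rewrite mul0r subr0.
have n0 : 0 < n.
  rewrite sqrtr_gt0 lt_neqAle addr_ge0 ?sqr_ge0// andbT eq_sym.
  rewrite paddr_eq0 ?sqr_ge0// !sqrf_eq0.
  by move: z0; rewrite eq_complex.
have tpi : `|t| <= pi by rewrite ler_norml t_le ltW.
rewrite ReE ler_pM2l// -(cos_norm t)
  [cos _ <= _]leNgt ltr_cos ?in_itv /= ?alpha0pi ?normr_ge0 //.
rewrite -leNgt.
by split=> [[/eqP|//]|]; [rewrite (negbTE z0)|right].
Qed.

Lemma wedge_pihalfE (R : realType) :
  wedge (pi / 2) = [set z : R[i] | complex.Re z <= 0].
Proof.
have pi0 := pi_ge0 R.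
apply/seteqP; split => z /=;
  rewrite (propext (wedgeP z _)) ?cos_pihalf ?mulr0 ?oppr_ge0//; lra.
Qed.

Lemma wedge0E (R : realType) : wedge 0 = [set z : R[i] | z <= 0].
Proof.
apply/seteqP; split => z /=;
  rewrite (propext (wedgeP z _)) ?lexx ?pi_ge0// cos0 mulr1 lecE /=.
  set d := _ + _ => h.
  have d0 : 0 <= d by rewrite addr_ge0 ?sqr_ge0.
  have s0 := sqrtr_ge0 d.
  have : Num.sqrt d ^+ 2 <= complex.Re z ^+ 2.
    by rewrite -(sqrrN (complex.Re z)) ler_pXn2r// nnegrE// (le_trans s0).
  rewrite sqr_sqrtr// /d gerDl => im0.
  rewrite eq_sym -sqrf_eq0 eq_le im0 sqr_ge0 /=; lra.
case/andP => /eqP <- h; rewrite expr0n addr0 sqrtr_sqr ler0_norm//.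
Qed.

(* Main.v *)
Require Import Defs.
From HB Require Import structures.
From mathcomp Require Import all_boot all_order all_algebra.
From mathcomp Require Import complex ring lra.
From mathcomp Require Import all_classical all_reals all_analysis.

Import Order.TTheory GRing.Theory Num.Theory.

Local Open Scope ring_scope.

(** Put [w = 1 + z_0], so that [|w| <= 1].  If [s = 1], then
    [r = (1 + w^2 + w z_1) / (2 - z_1)], and [|2 - z_1|^2 - |1 + w^2 + w z_1|^2]
    is a sum of nonnegative terms as soon as [Re z_1 <= 0].  If all [z_j] are
    real and nonpositive, put [x_j = - z_j / 2], [S = sum x_j] and
    [P = prod (1 + x_j)].  Then [P r = (P - 1 - S) + (1 + w^2) / 2 - w S], and
    since [P >= 1 + S] the triangle inequality gives
    [|P r| <= (P - 1 - S) + 1 + S = P]. *)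

(** Weierstrass product inequality: if [a] is the partial sum, a new factor leaves the surplus
    [x i * a], so the induction must also carry [0 <= a]. *)
Lemma prodr_1D_ge (F : numDomainType) (I : Type) (l : seq I) (P : pred I)
    (x : I -> F) : (forall i, P i -> 0 <= x i) ->
  1 + \sum_(i <- l | P i) x i <= \prod_(i <- l | P i) (1 + x i).
Proof.
move=> x0.
suff [] : 0 <= \sum_(i <- l | P i) x i /\
  1 + \sum_(i <- l | P i) x i <= \prod_(i <- l | P i) (1 + x i) by [].
apply: (big_rec2 (fun a b => 0 <= a /\ 1 + a <= b)) => [|i a b Pi [a0 ab]].
  by rewrite addr0.
have xi0 := x0 i Pi; split; first exact: addr_ge0.
apply: (@le_trans _ _ ((1 + x i) * (1 + a))).
  by rewrite -subr_ge0 [leRHS](_ : _ = x i * a) ?mulr_ge0//; ring.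
by rewrite ler_wpM2l// addr_ge0.
Qed.

Lemma normc_le_unit_disk (R : rcfType) (w z : R[i]) :
  `|w| <= 1 -> complex.Re z <= 0 -> `|1 + w ^+ 2 + w * z| <= `|2 - z|.
Proof.
case: w z => [a b] [x y] /=.
rewrite -(ler_pXn2r (ltn0Sn 1)) ?nnegrE// expr1n sqr_normc => /= w1 x0.
have {w1} ab : a ^+ 2 + b ^+ 2 <= 1.
  by move: w1; rewrite lecE /= => /andP[_]; rewrite !expr2; lra.
have a1 : -1 <= a by nra.
(* Completing the square in [y] writes |2 - z|^2 - |1 + w^2 + w z|^2 as exactly the sum of the
   following five products. *)
have ? : 0 <= (1 - (a ^+ 2 + b ^+ 2)) * (y + b) ^+ 2.
  by rewrite mulr_ge0 ?sqr_ge0// subr_ge0.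
have ? : 0 <= (1 - (a ^+ 2 + b ^+ 2)) * x ^+ 2.
  by rewrite mulr_ge0 ?sqr_ge0// subr_ge0.
have ? : 0 <= (1 - (a ^+ 2 + b ^+ 2)) * (3 + (a ^+ 2 + b ^+ 2)).
  by rewrite mulr_ge0 ?subr_ge0// !addr_ge0// sqr_ge0.
have ? : 0 <= b ^+ 2 * (3 + (a ^+ 2 + b ^+ 2)).
  by rewrite mulr_ge0 ?sqr_ge0// !addr_ge0// sqr_ge0.
(* The second factor is nonnegative because [a >= -1] and 1 + |w|^2 <= 2. *)
have ? : 0 <= - x * (4 + 2 * a * (1 + (a ^+ 2 + b ^+ 2))).
  rewrite mulr_ge0 ?oppr_ge0//; nra.
rewrite !normc_def lecR ler_wsqrtr//= -subr_ge0.
nra.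
Qed.

(** Over [R[i]] the order is partial, and [0 <= S] and [1 + S <= P] already force [S] and [P] to be
    real; no embedding of [R] is needed. *)
Lemma stab_real_le1 (F : numFieldType) (w S P : F) :
  `|w| <= 1 -> 0 <= S -> 1 + S <= P ->
  `|1 + (1 + 2^-1 * (w - 1)) * (w - 1 - 2 * S) / P| <= 1.
Proof.
move=> w1 S0 SP.
have P0 : 0 < P by apply: lt_le_trans SP; rewrite ltr_pwDl.
have -> : 1 + (1 + 2^-1 * (w - 1)) * (w - 1 - 2 * S) / P =
    ((P - (1 + S)) + (1 + w ^+ 2) / 2 - w * S) / P.
  by field; rewrite gt_eqF//= pnatr_eq0.
rewrite normf_div (gtr0_norm P0) ler_pdivrMr// mul1r.
apply: (@le_trans _ _ ((P - (1 + S)) + 1 + S)); last first.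
  by rewrite -subr_ge0 [leRHS](_ : _ = 0) //; ring.
apply: le_trans (ler_normB _ _) _; apply: lerD; last first.
  by rewrite normrM (ger0_norm S0) ler_piMl.
apply: le_trans (ler_normD _ _) _; apply: lerD.
  by rewrite ger0_norm // subr_ge0.
rewrite normf_div [`|2|]ger0_norm// ler_pdivrMr// mul1r.
apply: le_trans (ler_normD _ _) _.
by rewrite normr1 normrX [2](_ : _ = 1 + 1)// lerD2l exprn_ile1.
Qed.

Theorem theorem2p1 (R : realType) (s : nat) (hs : (1 <= s)%N)
    (z : 'I_s.+1 -> R[i]) :
  [/\ s = 1%N, `|1 + z ord0| <= 1 & wedge (pi / 2) (z (inord 1))]
  \/ [/\ (2 <= s)%N, `|1 + z ord0| <= 1
       & forall j : 'I_s.+1, (1 <= j)%N -> wedge 0 (z j)] ->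
  `|stab_fun z| <= 1.
Proof.
rewrite /stab_fun => -[[s1 w1]|[_ w1 zle0]].
  subst s; rewrite wedge_pihalfE /= [X in _ / X]big_mkcond !big_ord_recl !big_ord0 /=.
  have -> : lift ord0 ord0 = inord 1 :> 'I_2.
    by apply: val_inj; rewrite /= inordK.
  move: (z (inord 1)) => v v0; rewrite mul1r mulr1 addr0.
  (* The only pole, [v = 2], lies in the open right half-plane. *)
  have dN0 : 2 - v != 0.
    apply: contraTneq v0 => /eqP; rewrite subr_eq0 => /eqP <-.
    by rewrite raddfMn /= -ltNge ltr0n.
  set w := 1 + z ord0 in w1 *.
  have -> : z ord0 = w - 1 by rewrite /w addrC addKr.
  have -> : 1 + (1 + 2^-1 * (w - 1)) * (w - 1 + v) / (1 - 2^-1 * v) =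
      (1 + w ^+ 2 + w * v) / (2 - v).
    have d'N0 : 1 - 2^-1 * v != 0.
      apply: contraNneq dN0 => d0.
      have -> : 2 - v = 2 * (1 - 2^-1 * v) by field.
      by rewrite d0 mulr0.
    by field; rewrite dN0.
  by rewrite normf_div ler_pdivrMr ?normr_gt0// mul1r normc_le_unit_disk.
(* With the sign outside, [1 - 2^-1 * z j] is [1 + x j] by unfolding, so the product bound applies
   to the denominator as it stands. *)
pose x j := - (2^-1 * z j).
have x0 (j : 'I_s.+1) : (0 < j)%N -> 0 <= x j.
  move=> j0; have := zle0 j j0; rewrite wedge0E /= => zj.
  by rewrite /x oppr_ge0 pmulr_rle0 // invr_gt0.
rewrite (bigD1 ord0)//= (eq_bigl (fun j : 'I_s.+1 => 0 < j)%N); last first.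
  by move=> j; rewrite -val_eqE lt0n.
have -> : \sum_(j < s.+1 | (0 < j)%N) z j =
    - (2 * \sum_(j < s.+1 | (0 < j)%N) x j).
  by rewrite mulr_sumr -sumrN; apply: eq_bigr => j _; rewrite /x; field.
have -> : z ord0 = (1 + z ord0) - 1 by rewrite addrC addKr.
by apply: stab_real_le1; rewrite ?sumr_ge0// prodr_1D_ge.
Qed.
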